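(* Let $X,Y\in \operatorname{skew}(p)\times\mathbb{R}^{(n-p)\times p}$. If $\|X-Y\|_F<\tfrac{2}{3}$, then $$\operatorname{dist}_E\left(\varphi^{\mathsf{Cay}}_E(X),\varphi^{\mathsf{Cay}}_E(Y)\right)\le 2\arcsin\left(\tfrac{3}{2}\|X-Y\|_F\right).$$
   Context: Let $p\le n$ be positive integers. $\operatorname{St}(n,p)=\{U\in\mathbb{R}^{n\times p}: U^TU=I_p\}$ is the Stiefel manifold and $\operatorname{skew}(p)$ is the space of real skew-symmetric $p\times p$ matrices. An element of $\operatorname{skew}(p)\times\mathbb{R}^{(n-p)\times p}$ is written as a stacked $n\times p$ matrix $\begin{bmatrix} A \\ B \end{bmatrix}$ with $A\in\operatorname{skew}(p)$, $B\in\mathbb{R}^{(n-p)\times p}$, and $\|\cdot\|_F$ is the Frobenius norm. The Cayley transformation is $\operatorname{Cay}(A)=(I-A)^{-1}(I+A)$. The Cayley variant of the polar-light parametrization centered at $E=\begin{bmatrix} I_p \\ 0 \end{bmatrix}$ is $$\varphi^{\mathsf{Cay}}_E\left(\begin{bmatrix} A \\ B \end{bmatrix}\right)=\begin{bmatrix} \operatorname{Cay}(\tfrac12A) \\ B \end{bmatrix}(I_p+B^TB)^{-1/2}\in\operatorname{St}(n,p).$$ $\operatorname{dist}_E$ is the Riemannian distance on $\operatorname{St}(n,p)$ for the Euclidean metric $g_e(\xi,\Delta)=\operatorname{tr}(\xi^T\Delta)$ on each tangent space $T_U\operatorname{St}(n,p)=\{\xi\in\mathbb{R}^{n\times p}:U^T\xi+\xi^TU=0\}$.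 *)

(* Defs.v *)
From mathcomp Require Import all_boot all_order all_algebra.
From mathcomp Require Import all_classical all_reals all_analysis.
Set Implicit Arguments.
Unset Strict Implicit.
Unset Printing Implicit Defensive.
Import Order.TTheory GRing.Theory Num.Theory.
Import numFieldNormedType.Exports.
Local Open Scope classical_set_scope.
Local Open Scope ring_scope.

(* The library norm `|M| of a matrix is the sup norm, so the Frobenius norm is
   defined here. *)
Definition fnorm (R : realType) m n (M : 'M[R]_(m, n)) : R :=
  Num.sqrt (\sum_i \sum_j M i j ^+ 2).

Definition stiefel (R : realType) n p : set 'M[R]_(n, p) :=
  [set U | U^T *m U = 1%:M].
Arguments stiefel : clear implicits.

Definition euclidean_metric (R : realType) n p (xi Delta : 'M[R]_(n, p)) : R :=
  \tr (xi^T *m Delta).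

(* C^1 on the closed interval [a, b], expressed as the restriction of a C^1 map
   defined on the whole line. *)
Definition C1_on (R : realType) n p (a b : R) (gamma : R -> 'M[R]_(n, p)) :=
  exists c : R -> 'M[R]_(n, p),
    [/\ forall t, derivable c t 1,
        continuous (derive1 c) &
        forall t, a <= t <= b -> gamma t = c t].

(* The breakpoints are 0 :: s with 0 < s_0 < ... < s_k = 1; consecutive pieces
   agree at the common endpoint, so such a curve is continuous on [0, 1]. *)
Definition piecewise_C1 (R : realType) n p (gamma : R -> 'M[R]_(n, p)) :=
  exists s : seq R,
    [/\ path <%R 0 s, last 0 s = 1 &
        forall i, (i < size s)%N ->
          C1_on (nth 0 (0 :: s) i) (nth 0 s i) gamma].

(* For a piecewise C^1 curve the derivative exists outside the finite, hence
   negligible, set of breakpoints. *)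
Definition curve_length (R : realType) n p (gamma : R -> 'M[R]_(n, p)) :
    \bar R :=
  (\int[@lebesgue_measure R]_(t in `[0%R, 1%R])
     (Num.sqrt (euclidean_metric (derive1 gamma t) (derive1 gamma t)))%:E)%E.

Definition stiefel_curve (R : realType) n p (U V : 'M[R]_(n, p))
    (gamma : R -> 'M[R]_(n, p)) :=
  [/\ piecewise_C1 gamma,
      forall t, 0 <= t <= 1 -> stiefel R n p (gamma t),
      gamma 0 = U & gamma 1 = V].

(* Valued in \bar R: the infimum is +oo when no curve in the manifold joins U
   and V. *)
Definition dist_E (R : realType) n p (U V : 'M[R]_(n, p)) : \bar R :=
  ereal_inf [set curve_length gamma | gamma in stiefel_curve U V].

Definition Cay (R : realType) p (A : 'M[R]_p) : 'M[R]_p :=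
  invmx (1%:M - A) *m (1%:M + A).

Definition posdefmx (R : realType) p (S : 'M[R]_p) :=
  S^T = S /\ forall v : 'cV[R]_p, v != 0 -> 0 < \tr (v^T *m S *m v).

(* The symmetric positive definite square root, which exists and is unique when
   M is symmetric positive definite; 0 is the default when there is none. *)
Definition sqrtmx (R : realType) p (M : 'M[R]_p) : 'M[R]_p :=
  xget 0 [set S | posdefmx S /\ S *m S = M].

(* skew(p) x R^((n-p) x p), as matrices stacked from a p x p block (usubmx) and
   an (n-p) x p block (dsubmx). *)
Definition skew_prod (R : realType) n p : set 'M[R]_(p + (n - p), p) :=
  [set X | (usubmx X)^T = - usubmx X].
Arguments skew_prod : clear implicits.

(* The cast along p + (n - p) = n only retypes the row index. *)
Definition phi_Cay (R : realType) n p (hpn : (p <= n)%N)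
    (X : 'M[R]_(p + (n - p), p)) : 'M[R]_(n, p) :=
  let A := usubmx X in
  let B := dsubmx X in
  castmx (subnKC hpn, erefl p) (col_mx (Cay (2^-1 *: A)) B)
    *m invmx (sqrtmx (1%:M + B^T *m B)).

(* Main.v *)
(* The curve t |-> phi(X + t (Y - X)) stays on the Stiefel manifold and has speed
   at most 3 |Y - X|, so the distance is at most 3 |X - Y|, and
   x <= asin x on [0, 1] finishes. Write phi = M S with M = [Cay(A/2); B],
   T = (1 + B^T B)^(1/2) and S = T^-1. The derivative of Cay(A/2) is N A' N with
   N = (1 - A/2)^-1 a contraction. The derivative Q of T solves the Sylvester
   equation T Q + Q T = B'^T B + B^T B', and S' = - S Q S. Since M S has
   orthonormal columns,
     |phi'| <= |[A'; B']| + |Q S|,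
   where |Q S| <= |Q S + S Q| <= 2 |B'| because tr(D^T S D S') >= 0 for positive
   definite S, S', and because B S is a contraction. *)
Require Import Defs.
From mathcomp Require Import all_boot all_order all_algebra.
From mathcomp Require Import all_classical all_reals all_analysis.
From mathcomp Require Import measurable_realfun complex ring lra.
Set Implicit Arguments.
Unset Strict Implicit.
Unset Printing Implicit Defensive.
Import Order.TTheory GRing.Theory Num.Theory.
Import numFieldNormedType.Exports.
Local Open Scope classical_set_scope.
Local Open Scope ring_scope.

(** * Positive definite matrices and their square roots *)

Lemma poly_interpolation (F : fieldType) (g : F -> F) (s : seq F) :
  exists f : {poly F}, {in s, forall x, f.[x] = g x}.
Proof.
elim: s => [|a s [f fs]]; first by exists 0.
have [as_|nas] := boolP (a \in s).
  by exists f => x; rewrite inE => /predU1P[->|]; exact: fs.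
pose q := \prod_(y <- s) ('X - y%:P).
have qa : q.[a] != 0 by rewrite -rootE root_prod_XsubC.
(* Newton's correction: [q] vanishes on [s], so adding a multiple of it only repairs the value at
   [a]. *)
exists (f + ((g a - f.[a]) / q.[a])%:P * q) => x.
rewrite inE hornerD hornerM hornerC => /predU1P[->|xs].
  by rewrite divfK // addrC subrK.
have /rootP -> : root q x by rewrite root_prod_XsubC.
by rewrite mulr0 addr0 fs.
Qed.

Lemma trmx_horner_mx (R : comNzRingType) n (A : 'M[R]_n.+1) (f : {poly R}) :
  A^T = A -> (horner_mx A f)^T = horner_mx A f.
Proof.
move=> As; elim/poly_ind: f => [|f c IH]; first by rewrite !rmorph0 trmx0.
rewrite rmorphD rmorphM /= horner_mx_X horner_mx_C linearD /= trmx_mul IH As.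
by rewrite tr_scalar_mx; congr (_ + _); exact/esym/comm_horner_mx.
Qed.

Lemma tr_sqnorm (R : realType) m n (M : 'M[R]_(m, n)) :
  \tr (M^T *m M) = \sum_i \sum_j M i j ^+ 2.
Proof.
rewrite /mxtrace exchange_big /=; apply: eq_bigr => j _.
by rewrite mxE; apply: eq_bigr => i _; rewrite mxE expr2.
Qed.

Lemma tr_sqnorm_ge0 (R : realType) m n (M : 'M[R]_(m, n)) : 0 <= \tr (M^T *m M).
Proof. by rewrite tr_sqnorm; do 2!(apply: sumr_ge0 => ? _); exact: sqr_ge0. Qed.

Lemma tr_sqnorm_eq0 (R : realType) m n (M : 'M[R]_(m, n)) :
  (\tr (M^T *m M) == 0) = (M == 0).
Proof.
apply/eqP/eqP => [|->]; last by rewrite mulmx0 mxtrace0.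
rewrite tr_sqnorm => /psumr_eq0P M0; apply/matrixP => i j; rewrite mxE.
have /psumr_eq0P/(_ j isT)/eqP :=
  M0 (fun i _ => sumr_ge0 _ (fun j _ => sqr_ge0 _)) i isT.
by rewrite sqrf_eq0 => /(_ (fun j _ => sqr_ge0 _))/eqP.
Qed.

Lemma tr_sqnorm_gt0 (R : realType) m n (M : 'M[R]_(m, n)) :
  M != 0 -> 0 < \tr (M^T *m M).
Proof. by move=> M0; rewrite lt_def tr_sqnorm_eq0 M0 tr_sqnorm_ge0. Qed.

Lemma posdefmx_eigenvalue_gt0 (R : realType) p (P : 'M[R]_p) (a : R) :
  posdefmx P -> eigenvalue P a -> 0 < a.
Proof.
move=> [_ Ppos] /eigenvalueP[v vP v0].
have vT0 : v^T != 0 by rewrite trmx_eq0.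
have := Ppos _ vT0; rewrite trmxK vP -scalemxAl mxtraceZ.
have := tr_sqnorm_gt0 vT0; rewrite trmxK => v_gt0.
by rewrite pmulr_lgt0.
Qed.

Lemma posdefmx_unit (R : realType) p (P : 'M[R]_p) : posdefmx P -> P \in unitmx.
Proof.
move=> [Ps Ppos]; rewrite -row_free_unit; apply/row_freeP.
apply/row_freeP/inj_row_free => v vP; apply/eqP/contraT => v0.
have := Ppos v^T; rewrite trmx_eq0 trmxK vP mul0mx mxtrace0 ltxx.
by move=> /(_ v0).
Qed.

(** The complexification of [P] is hermitian, so the complex spectral theorem diagonalizes it with
    real spectrum; [d] is that spectrum brought back to [R], while [U] stays complex. *)
Lemma symmetric_spectrum (R : realType) p (P : 'M[R]_p.+1) : P^T = P ->
  exists (U : 'M[R[i]]_p.+1) (d : 'rV[R]_p.+1),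
    [/\ U \in unitmx,
        map_mx (real_complex R) P =
          invmx U *m diag_mx (map_mx (real_complex R) d) *m U &
        forall i, eigenvalue P (d 0 i)].
Proof.
move=> Ps; set c := real_complex R; pose PC := map_mx c P.
have PCh : PC \is hermsymmx.
  apply: realsym_hermsym.
    apply/is_hermitianmxP; rewrite expr0 scale1r map_mx_id //.
    by rewrite /PC map_trmx Ps.
  by apply/mxOverP => i j; rewrite mxE complex_real.
have /orthomx_spectralP := hermitian_normalmx PCh.
have /mxOverP := hermitian_spectral_diag_real PCh.
have := spectral_unit PC.
move: (spectralmx PC) (spectral_diag PC) => U d Uu dreal PE.
have [e dE] : exists e : 'rV[R]_p.+1, d = map_mx c e.
  exists (map_mx (@complex.Re R) d).
  by apply/rowP => i; rewrite !mxE; have /complex_realP[x ->] := dreal 0 i.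
rewrite {}dE {d dreal} in PE.
exists U, e; split; [exact: Uu | exact: PE | move=> i].
(* Being an eigenvalue can be checked over [R[i]], where row [i] of [U] is a left eigenvector. *)
rewrite -(eigenvalue_map c).
apply/eigenvalueP; exists (row i U).
  rewrite -/PC {1}PE -row_mul !mulmxA mulmxV // mul1mx row_mul row_diag_mx.
  by rewrite -scalemxAl -rowE mxE.
rewrite rowE mulmx_free_eq0 ?row_free_unit //; apply/eqP => /matrixP/(_ 0 i)/eqP.
by rewrite !mxE !eqxx oner_eq0.
Qed.

Lemma posdefmx_sqrt_exists (R : realType) p (P : 'M[R]_p) :
  posdefmx P -> exists S, posdefmx S /\ S *m S = P.
Proof.
case: p P => [|p] P Ppd.
  exists 0; split; last by rewrite flatmx0 [P]flatmx0.
  by split=> [|v]; rewrite ?[v]flatmx0 ?[0^T]flatmx0 ?eqxx.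
have [Ps Ppos] := Ppd.
have [U [d [Uu PE dP]]] := symmetric_spectrum Ps.
have d_ge0 i : 0 <= d 0 i by rewrite ltW // (posdefmx_eigenvalue_gt0 Ppd).
(* Interpolating the fourth root, rather than the square root, makes the square
   root of [P] itself a square, hence positive definite. *)
have [f fE] := poly_interpolation (fun x => Num.sqrt (Num.sqrt x))
  [seq d 0 i | i : 'I_p.+1].
pose G := horner_mx P f.
have Gs : G^T = G by exact: trmx_horner_mx.
have G4 : G *m G *m (G *m G) = P.
  (* After complexification a polynomial in [P] acts entrywise on the diagonal, where [f] takes
     fourth roots of the eigenvalues. *)
  apply: (map_mx_inj (f := real_complex R)); rewrite !map_mxM /G map_horner_mx PE.
  rewrite horner_mx_uconjC // horner_mx_diag.
  set D := diag_mx _.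
  have -> : invmx U *m D *m U *m (invmx U *m D *m U) = invmx U *m (D *m D) *m U.
    by rewrite !mulmxA mulmxK // .
  rewrite !mulmxA mulmxK // -!mulmxA; congr (_ *m _).
  rewrite !mulmxA; congr (_ *m _).
  rewrite /D !mulmx_diag; congr diag_mx; apply/rowP => i; rewrite !mxE.
  rewrite horner_map /= fE; last by apply/mapP; exists i; rewrite ?mem_enum.
  rewrite -!(rmorphM (real_complex R)) -mulrA -!expr2 sqr_sqrtr ?sqrtr_ge0 //.
  by rewrite sqr_sqrtr.
have Gu : G \in unitmx.
  by have := posdefmx_unit Ppd; rewrite -G4 !unitmx_mul => /andP[/andP[]].
exists (G *m G); split=> //; split; first by rewrite trmx_mul Gs.
move=> v v0; have -> : v^T *m (G *m G) *m v = (G *m v)^T *m (G *m v).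
  by rewrite trmx_mul Gs !mulmxA.
apply: tr_sqnorm_gt0; apply: contra v0 => /eqP/(congr1 (mulmx (invmx G))).
by rewrite mulKmx // mulmx0 => /eqP.
Qed.

Lemma sqrtmxP (R : realType) p (P : 'M[R]_p) :
  posdefmx P -> posdefmx (sqrtmx P) /\ sqrtmx P *m sqrtmx P = P.
Proof. by move=> /posdefmx_sqrt_exists/xgetPex; exact. Qed.

(** * Frobenius norm estimates for Gram roots and the Sylvester operator *)

Local Notation dot := (@euclidean_metric _ _ _).
Local Notation sqn X := (euclidean_metric X X).

Section frobenius.
Variable R : realType.

Lemma dotC m n (X Y : 'M[R]_(m, n)) : dot X Y = dot Y X.
Proof. by rewrite /euclidean_metric -mxtrace_tr trmx_mul trmxK. Qed.

Lemma dotDr m n (X Y Z : 'M[R]_(m, n)) : dot X (Y + Z) = dot X Y + dot X Z.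
Proof. by rewrite /euclidean_metric mulmxDr mxtraceD. Qed.

Lemma dotZr m n a (X Y : 'M[R]_(m, n)) : dot X (a *: Y) = a * dot X Y.
Proof. by rewrite /euclidean_metric -scalemxAr mxtraceZ. Qed.

Lemma dot_mull k m n (A : 'M[R]_(k, m)) (X : 'M[R]_(m, n)) Y :
  dot (A *m X) Y = dot X (A^T *m Y).
Proof. by rewrite /euclidean_metric trmx_mul mulmxA. Qed.

Lemma dot_tr m n (X Y : 'M[R]_(m, n)) : dot X^T Y^T = dot X Y.
Proof.
by rewrite dotC /euclidean_metric trmxK mxtrace_mulC.
Qed.

Lemma dot_mulr k m n (A : 'M[R]_(n, k)) (X : 'M[R]_(m, n)) Y :
  dot (X *m A) Y = dot X (Y *m A^T).
Proof. by rewrite -dot_tr trmx_mul dot_mull -trmx_mul dot_tr. Qed.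

Lemma sqn_ge0 m n (X : 'M[R]_(m, n)) : 0 <= sqn X.
Proof. exact: tr_sqnorm_ge0. Qed.

Lemma sqn_tr m n (X : 'M[R]_(m, n)) : sqn X^T = sqn X.
Proof. exact: dot_tr. Qed.

Lemma sqnD m n (X Y : 'M[R]_(m, n)) : sqn (X + Y) = sqn X + 2 * dot X Y + sqn Y.
Proof. by rewrite dotDr ![dot (X + Y) _]dotC !dotDr [dot Y X]dotC; ring. Qed.

Lemma sqnZ m n a (X : 'M[R]_(m, n)) : sqn (a *: X) = a ^+ 2 * sqn X.
Proof. by rewrite dotZr dotC dotZr mulrA. Qed.

Lemma fnormE m n (X : 'M[R]_(m, n)) : fnorm X = Num.sqrt (sqn X).
Proof. by rewrite /fnorm /euclidean_metric tr_sqnorm. Qed.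

Lemma fnorm_ge0 m n (X : 'M[R]_(m, n)) : 0 <= fnorm X.
Proof. exact: sqrtr_ge0. Qed.

Lemma sqr_fnorm m n (X : 'M[R]_(m, n)) : fnorm X ^+ 2 = sqn X.
Proof. by rewrite fnormE sqr_sqrtr // sqn_ge0. Qed.

Lemma ler_fnorm k l m n (X : 'M[R]_(k, l)) (Y : 'M[R]_(m, n)) :
  (fnorm X <= fnorm Y) = (sqn X <= sqn Y).
Proof. by rewrite -!sqr_fnorm ler_sqr ?nnegrE ?fnorm_ge0. Qed.

Lemma fnorm_tr m n (X : 'M[R]_(m, n)) : fnorm X^T = fnorm X.
Proof. by rewrite !fnormE sqn_tr. Qed.

Lemma fnormN m n (X : 'M[R]_(m, n)) : fnorm (- X) = fnorm X.
Proof. by rewrite !fnormE -scaleN1r sqnZ sqrrN expr1n mul1r. Qed.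

Lemma fnorm_eq0 m n (X : 'M[R]_(m, n)) : (fnorm X == 0) = (X == 0).
Proof. by rewrite -(tr_sqnorm_eq0 X) -/(sqn X) -sqr_fnorm sqrf_eq0. Qed.

(** Cauchy-Schwarz, from the nonnegative square of |Y| X - |X| Y. Zero matrices are set apart
    because the argument divides by |X| |Y|. *)
Lemma dot_le_fnorm m n (X Y : 'M[R]_(m, n)) : dot X Y <= fnorm X * fnorm Y.
Proof.
have [->|X0] := eqVneq X 0.
  by rewrite /euclidean_metric trmx0 mul0mx mxtrace0 mulr_ge0 ?fnorm_ge0.
have [->|Y0] := eqVneq Y 0.
  by rewrite /euclidean_metric mulmx0 mxtrace0 mulr_ge0 ?fnorm_ge0.
have a0 : 0 < fnorm X by rewrite lt_def fnorm_eq0 X0 fnorm_ge0.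
have b0 : 0 < fnorm Y by rewrite lt_def fnorm_eq0 Y0 fnorm_ge0.
have := sqn_ge0 (fnorm Y *: X + - fnorm X *: Y).
rewrite sqnD !sqnZ dotZr dotC dotZr -!sqr_fnorm dotC => h.
have {}h : 0 <= 2 * (fnorm X * fnorm Y) * (fnorm X * fnorm Y - dot X Y).
  by apply: le_trans h _; rewrite le_eqVlt; apply/orP; left; apply/eqP; ring.
by rewrite -subr_ge0; rewrite pmulr_rge0 in h; rewrite // !mulr_gt0.
Qed.

Lemma ler_fnormD m n (X Y : 'M[R]_(m, n)) : fnorm (X + Y) <= fnorm X + fnorm Y.
Proof.
rewrite -ler_sqr ?nnegrE ?addr_ge0 ?fnorm_ge0 // sqr_fnorm sqnD -!sqr_fnorm.
have := dot_le_fnorm X Y; nra.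
Qed.

(** With roots [G] of [S] and [G'] of [S'], the product is the squared norm of G D G'. *)
Lemma dot_posdef_ge0 m n (S : 'M[R]_m) (S' : 'M[R]_n) (D : 'M[R]_(m, n)) :
  posdefmx S -> posdefmx S' -> 0 <= dot D (S *m D *m S').
Proof.
move=> /posdefmx_sqrt_exists[G [[Gs _] <-]] /posdefmx_sqrt_exists[G' [[Gs' _] <-]].
have -> : dot D (G *m G *m D *m (G' *m G')) = sqn (G *m D *m G').
  by rewrite dot_mulr dot_mull Gs Gs' !mulmxA.
exact: sqn_ge0.
Qed.

(** The cross term of the expanded square is 2 <D, S D S'>, nonnegative by [dot_posdef_ge0]. *)
Lemma sqn_sylvester m n (S : 'M[R]_m) (S' : 'M[R]_n) (D : 'M[R]_(m, n)) :
  posdefmx S -> posdefmx S' -> sqn (S *m D) + sqn (D *m S') <= sqn (S *m D + D *m S').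
Proof.
move=> Sp Sp'; rewrite sqnD -addrA lerD2l ler_wpDl // mulr_ge0 // dotC dot_mulr.
by have [-> _] := Sp'; exact: dot_posdef_ge0.
Qed.

Lemma posdefmx_inv p (T : 'M[R]_p) : posdefmx T -> posdefmx (invmx T).
Proof.
move=> Tp; have Tu := posdefmx_unit Tp; case: Tp => Ts Tpos.
split=> [|v v0]; first by rewrite trmx_inv Ts.
have : invmx T *m v != 0.
  by apply: contra v0 => /eqP/(congr1 (mulmx T)); rewrite mulKVmx // mulmx0 => /eqP.
by move=> /Tpos; rewrite trmx_mul trmx_inv Ts mulmxKV // mulmxA.
Qed.

Lemma posdefmx_1D m p (B : 'M[R]_(m, p)) : posdefmx (1%:M + B^T *m B).
Proof.
split=> [|v v0]; first by rewrite linearD /= trmx1 trmx_mul trmxK.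
rewrite mulmxDr mulmx1 mulmxDl mxtraceD ltr_pwDl ?tr_sqnorm_gt0 //.
by rewrite mulmxA -trmx_mul -mulmxA tr_sqnorm_ge0.
Qed.

Definition gram_root m p (B : 'M[R]_(m, p)) (T : 'M[R]_p) :=
  posdefmx T /\ T *m T = 1%:M + B^T *m B.

Lemma gram_root_sqrtmx m p (B : 'M[R]_(m, p)) : gram_root B (sqrtmx (1%:M + B^T *m B)).
Proof. exact/sqrtmxP/posdefmx_1D. Qed.

Section root.
Variables (m p : nat) (B : 'M[R]_(m, p)) (T : 'M[R]_p).
Hypothesis BT : gram_root B T.
Let Tpos : posdefmx T := BT.1.
Let Ts : T^T = T := Tpos.1.
Let TT : T *m T = 1%:M + B^T *m B := BT.2.
Let Tu : T \in unitmx := posdefmx_unit Tpos.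

(** Since [T] is symmetric, |T X|^2 = <X, T^2 X>. Hence [T] never shrinks a matrix, and both
    [invmx T] and [B *m invmx T] are contractions. *)
Lemma sqn_mul_gram_root n (X : 'M[R]_(p, n)) : sqn (T *m X) = sqn X + sqn (B *m X).
Proof.
by rewrite dot_mull Ts mulmxA TT mulmxDl mul1mx dotDr dot_mull mulmxA.
Qed.

Lemma fnorm_mul_gram_root n (X : 'M[R]_(p, n)) : fnorm X <= fnorm (T *m X).
Proof. by rewrite ler_fnorm sqn_mul_gram_root lerDl sqn_ge0. Qed.

(** This lower bound on X |-> T X + X T' gives uniqueness of Sylvester solutions and all the
    continuity estimates for roots. *)
Lemma fnorm_root_sylvester n m' (B' : 'M[R]_(m', n)) T' (X : 'M[R]_(p, n)) :
  gram_root B' T' -> fnorm X <= fnorm (T *m X + X *m T').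
Proof.
move=> [Tp' _]; rewrite ler_fnorm; apply: le_trans (sqn_sylvester X Tpos Tp').
by rewrite sqn_mul_gram_root -addrA lerDl addr_ge0 ?sqn_ge0.
Qed.

Lemma fnorm_invroot_mul n (X : 'M[R]_(p, n)) : fnorm (invmx T *m X) <= fnorm X.
Proof. by apply: le_trans (fnorm_mul_gram_root _) _; rewrite mulKVmx. Qed.

Lemma fnorm_mul_invroot n (X : 'M[R]_(n, p)) : fnorm (X *m invmx T) <= fnorm X.
Proof.
by rewrite -fnorm_tr trmx_mul trmx_inv Ts (le_trans (fnorm_invroot_mul _)) ?fnorm_tr.
Qed.

Lemma fnorm_frame_mul n (X : 'M[R]_(p, n)) : fnorm (B *m invmx T *m X) <= fnorm X.
Proof.
have := sqn_mul_gram_root (invmx T *m X); rewrite mulKVmx // ler_fnorm => ->.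
by rewrite mulmxA lerDr sqn_ge0.
Qed.

(** The adjoint of a contraction is a contraction: |Y|^2 = <X, B T^-1 Y> <= |X| |Y|. *)
Lemma fnorm_frametr_mul n (X : 'M[R]_(m, n)) : fnorm (invmx T *m B^T *m X) <= fnorm X.
Proof.
set Y := _ *m X.
have Y2 : fnorm Y ^+ 2 <= fnorm X * fnorm Y.
  rewrite sqr_fnorm {1}/Y dot_mull.
  apply: le_trans (dot_le_fnorm _ _) _; rewrite ler_wpM2l ?fnorm_ge0 //.
  by rewrite trmx_mul trmxK trmx_inv Ts fnorm_frame_mul.
have := fnorm_ge0 Y; rewrite le_eqVlt => /predU1P[<-|Y0]; first exact: fnorm_ge0.
by rewrite -(ler_pM2r Y0) -expr2.
Qed.

(* Multiplying the Sylvester equation by [invmx T] on both sides turns the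
   unbounded [B] into the contraction [B *m invmx T]. *)
Lemma fnorm_deriv_root (D : 'M[R]_(m, p)) (Q : 'M[R]_p) :
  T *m Q + Q *m T = D^T *m B + B^T *m D -> fnorm (Q *m invmx T) <= 2 * fnorm D.
Proof.
move=> /(congr1 (fun Z => invmx T *m Z *m invmx T)).
rewrite mulmxDr mulKmx // mulmxDl mulmxA mulmxK // => eqQ.
have : sqn (Q *m invmx T) <= sqn (invmx T *m Q + Q *m invmx T).
  have Sp := posdefmx_inv Tpos.
  by apply: le_trans (sqn_sylvester _ Sp Sp); rewrite lerDr sqn_ge0.
rewrite -ler_fnorm addrC {}eqQ => /le_trans; apply.
rewrite mulmxDr mulmxDl (le_trans (ler_fnormD _ _)) //.
have -> : invmx T *m (D^T *m B) *m invmx T = (invmx T *m (B^T *m D) *m invmx T)^T.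
  by rewrite !trmx_mul trmxK trmx_inv Ts !mulmxA.
suff h : fnorm (invmx T *m (B^T *m D) *m invmx T) <= fnorm D.
  by rewrite fnorm_tr mulr_natl mulr2n lerD.
by rewrite (le_trans (fnorm_mul_invroot _)) // mulmxA fnorm_frametr_mul.
Qed.

End root.

(** * Skew-symmetric matrices and the Cayley transformation *)

Section skew.
Variables (p : nat) (A : 'M[R]_p).
Hypothesis As : A^T = - A.

(** For skew [A], [X] and [A *m X] are orthogonal, so Pythagoras applies. Invertibility of 1 - A and
    contractivity of its inverse follow. *)
Lemma fnorm_mul_1Bskew n (X : 'M[R]_(p, n)) : fnorm X <= fnorm ((1%:M - A) *m X).
Proof.
rewrite mulmxBl mul1mx ler_fnorm sqnD.
have -> : dot X (- (A *m X)) = 0.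
  have : dot X (A *m X) = - dot X (A *m X).
    by rewrite -[in LHS](trmxK A) -dot_mull As mulNmx dotC -scaleN1r dotZr mulN1r.
  by move=> h; rewrite -scaleN1r dotZr; lra.
by rewrite mulr0 addr0 lerDl sqn_ge0.
Qed.

Lemma skew_unit : 1%:M - A \in unitmx.
Proof.
rewrite -unitmx_tr -row_free_unit; apply/inj_row_free => v /(congr1 trmx).
rewrite trmx_mul trmxK trmx0 => h; apply/eqP; rewrite -trmx_eq0 -fnorm_eq0.
rewrite eq_le fnorm_ge0 andbT (le_trans (fnorm_mul_1Bskew _)) // h.
by rewrite le_eqVlt fnorm_eq0 eqxx.
Qed.

Lemma fnorm_invskew_mul n (X : 'M[R]_(p, n)) : fnorm (invmx (1%:M - A) *m X) <= fnorm X.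
Proof. by apply: le_trans (fnorm_mul_1Bskew _) _; rewrite mulKVmx ?skew_unit. Qed.

(** Writing 1 + A = 2 - (1 - A) makes [Cay] affine in the resolvent, so its increments reduce to
    those of an inverse. *)
Lemma CayE : Cay A = 2 *: invmx (1%:M - A) - 1%:M.
Proof.
rewrite /Cay (_ : 1%:M + A = 2 *: 1%:M - (1%:M - A)); last first.
  by apply/matrixP => i j; rewrite !mxE; ring.
by rewrite mulmxBr mulVmx ?skew_unit // -scalemxAr mulmx1.
Qed.

Lemma Cay_orthogonal : (Cay A)^T *m Cay A = 1%:M.
Proof.
have ue : 1%:M + A \in unitmx.
  by rewrite -unitmx_tr linearD /= trmx1 As skew_unit.
have comm : (1%:M + A) *m (1%:M - A) = (1%:M - A) *m (1%:M + A).
  by rewrite mulmxBr mulmx1 mulmxBl mul1mx mulmxDl mulmxDr mul1mx mulmx1.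
rewrite /Cay trmx_mul trmx_inv linearB linearD /= trmx1 As opprK.
have -> : (1%:M - A) *m invmx (1%:M + A) = invmx (1%:M + A) *m (1%:M - A).
  by rewrite -[LHS](mulKmx ue) (mulmxA (1%:M + A)) comm mulmxK.
by rewrite -mulmxA mulKVmx ?skew_unit // mulVmx.
Qed.

End skew.

Lemma fnorm_mul_invskew p (A : 'M[R]_p) n (X : 'M[R]_(n, p)) :
  A^T = - A -> fnorm (X *m invmx (1%:M - A)) <= fnorm X.
Proof.
move=> As; rewrite -fnorm_tr trmx_mul trmx_inv linearB /= trmx1 As opprK.
rewrite -[A]opprK; apply: le_trans (fnorm_invskew_mul _ _) _; last by rewrite fnorm_tr.
by rewrite linearN /= As.
Qed.

End frobenius.

(** * Limits of matrix-valued functions *)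

Section matrix_limits.
Context (R : realType) (T : Type) (F : set_system T) {FF : Filter F}.

Lemma cvg_mxP m n (f : T -> 'M[R]_(m, n)) (A : 'M[R]_(m, n)) :
  f x @[x --> F] --> A <-> forall i j, f x i j @[x --> F] --> A i j.
Proof.
split=> [/cvgrPdist_le fA i j|fA]; apply/cvgrPdist_le => e e0.
  near=> x.
  have : `|A - f x| <= e by near: x; exact: fA.
  apply: le_trans; rewrite [leRHS]/Num.Def.normr/= mx_normrE.
  by apply: le_trans; last exact: (le_bigmax _ _ (i, j)); rewrite !mxE.
near=> x.
rewrite [leLHS]/Num.Def.normr/= mx_normrE (bigmax_le _ (ltW e0))//= => i _.
rewrite !mxE; move: i; near: x; apply: filter_forall => /= i.
by have /cvgrPdist_le/(_ _ e0) := fA i.1 i.2.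
Unshelve. all: by end_near. Qed.

Lemma cvg_sum (I : Type) (r : seq I) (f : I -> T -> R) (a : I -> R) :
  (forall i, f i x @[x --> F] --> a i) ->
  (\sum_(i <- r) f i x) @[x --> F] --> \sum_(i <- r) a i.
Proof.
move=> fa; elim: r => [|i r IH].
  by rewrite big_nil; under eq_fun do rewrite big_nil; exact: cvg_cst.
by rewrite big_cons; under eq_fun do rewrite big_cons; exact: cvgD (fa i) IH.
Qed.

Lemma cvg_mulmx k m n (f : T -> 'M[R]_(k, m)) (g : T -> 'M[R]_(m, n))
    (A : 'M[R]_(k, m)) (B : 'M[R]_(m, n)) :
  f x @[x --> F] --> A -> g x @[x --> F] --> B ->
  (f x *m g x) @[x --> F] --> A *m B.
Proof.
move=> /cvg_mxP fA /cvg_mxP gB; apply/cvg_mxP => i j; rewrite mxE.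
under eq_fun do rewrite mxE; apply: cvg_sum => l; exact: cvgM (fA i l) (gB l j).
Qed.

Lemma cvg_trmx m n (f : T -> 'M[R]_(m, n)) (A : 'M[R]_(m, n)) :
  f x @[x --> F] --> A -> (f x)^T @[x --> F] --> A^T.
Proof.
move=> /cvg_mxP fA; apply/cvg_mxP => i j; rewrite mxE.
by under eq_fun do rewrite mxE; exact: fA.
Qed.

Lemma cvg_col_mx m1 m2 n (f : T -> 'M[R]_(m1, n)) (g : T -> 'M[R]_(m2, n))
    (A : 'M[R]_(m1, n)) (B : 'M[R]_(m2, n)) :
  f x @[x --> F] --> A -> g x @[x --> F] --> B ->
  col_mx (f x) (g x) @[x --> F] --> col_mx A B.
Proof.
move=> /cvg_mxP fA /cvg_mxP gB; apply/cvg_mxP => i j.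
rewrite -(splitK i); case: (fintype.split i) => k /=.
  by rewrite col_mxEu; under eq_fun do rewrite col_mxEu; exact: fA.
by rewrite col_mxEd; under eq_fun do rewrite col_mxEd; exact: gB.
Qed.

Lemma cvg_fnorm m n (f : T -> 'M[R]_(m, n)) (A : 'M[R]_(m, n)) :
  f x @[x --> F] --> A -> fnorm (f x) @[x --> F] --> fnorm A.
Proof.
move=> /cvg_mxP fA; rewrite /fnorm; apply: continuous_cvg; first exact: sqrt_continuous.
apply: cvg_sum => i; apply: cvg_sum => j.
by rewrite expr2; under eq_fun do rewrite expr2; exact: cvgM.
Qed.

(** A squeeze principle for matrices known only through an equation: inverses, square roots and
    Sylvester solutions. Each entry is bounded by the Frobenius norm. *)
Lemma cvg_fnorm_le m n k l (f : T -> 'M[R]_(m, n)) (A : 'M[R]_(m, n))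
    (e : T -> 'M[R]_(k, l)) :
  (forall x, fnorm (f x - A) <= fnorm (e x)) -> e x @[x --> F] --> (0 : 'M[R]_(k, l)) ->
  f x @[x --> F] --> A.
Proof.
move=> fe /cvg_fnorm; have /eqP -> : fnorm (0 : 'M[R]_(k, l)) == 0 by rewrite fnorm_eq0.
move=> /cvgrPdist_le e0; apply/cvg_mxP => i j; apply/cvgrPdist_le => d d0.
near=> x; have : `|0 - fnorm (e x)| <= d by near: x; exact: e0.
rewrite sub0r normrN ger0_norm ?fnorm_ge0 //; apply: le_trans.
rewrite distrC; apply: le_trans (fe x); rewrite -sqrtr_sqr /fnorm ler_wsqrtr //.
rewrite (bigD1 i) //= (bigD1 j) //= !mxE -addrA lerDl addr_ge0 //.
  by apply: sumr_ge0 => ? _; exact: sqr_ge0.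
by do 2!(apply: sumr_ge0 => ? _); exact: sqr_ge0.
Unshelve. all: by end_near. Qed.

End matrix_limits.

(** * The curve through the parametrization: slopes, derivative and speed *)

Lemma is_derive_slope (R : realType) (V : normedModType R) (c q : R -> V) (t : R) :
  (forall s, c s - c t = (s - t) *: q s) -> q s @[s --> t] --> q t ->
  is_derive t 1 c (q t).
Proof.
move=> cq qt.
have ct : (h^-1 *: ((c \o shift t) (h *: 1) - c t)) @[h --> 0^'] --> q t.
  have qt0 : (q \o shift t) h @[h --> 0^'] --> q t.
    apply: cvg_trans; first exact/cvg_app/cvg_within.
    by rewrite cvg_comp_shift add0r.
  apply: cvg_trans qt0; apply: near_eq_cvg; near=> h.
  have h0 : h != 0 by near: h; exact: nbhs_dnbhs_neq.
  by rewrite /= cq addrK scalerA [h%:A]mulr1 mulVf // scale1r.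
split; first by apply/cvg_ex; exists (q t).
exact: cvg_lim.
Unshelve. all: by end_near. Qed.

(** The solution X of T X + X T' = W, obtained by inverting the matrix of the operator on vectorized
    matrices. Two coefficients are allowed because increments involve roots at two parameters. *)
Definition sylvester (R : comUnitRingType) p (T T' W : 'M[R]_p) : 'M[R]_p :=
  vec_mx (mxvec W *m invmx (lin_mulmx T + lin_mulmxr T')).

Section curve.
Variables (R : realType) (m p : nat).

(** The operator is bounded below, hence injective, hence invertible in finite dimension. *)
Lemma sylvesterP (B B' : 'M[R]_(m, p)) T T' W : gram_root B T -> gram_root B' T' ->
  T *m sylvester T T' W + sylvester T T' W *m T' = W.
Proof.
move=> BT BT'; pose L := lin_mulmx T + lin_mulmxr T'.
have LE X : mxvec X *m L = mxvec (T *m X + X *m T').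
  by rewrite mulmxDr !mul_vec_lin linearD.
have Lu : L \in unitmx.
  rewrite -row_free_unit; apply/inj_row_free => v vL; rewrite -[v]vec_mxK.
  suff -> : vec_mx v = 0 by rewrite linear0.
  apply/eqP; rewrite -fnorm_eq0 eq_le fnorm_ge0 andbT.
  apply: le_trans (fnorm_root_sylvester BT _ BT') _.
  have /(congr1 vec_mx) : mxvec (T *m vec_mx v + vec_mx v *m T') = 0.
    by rewrite -LE vec_mxK.
  by rewrite mxvecK linear0 => ->; rewrite le_eqVlt fnorm_eq0 eqxx.
by apply: (can_inj mxvecK); rewrite -LE /sylvester vec_mxK mulmxKV.
Qed.

Variables (A DA : 'M[R]_p) (B DB : 'M[R]_(m, p)).
Hypotheses (As : A^T = - A) (DAs : DA^T = - DA).

Let At (t : R) := 2^-1 *: (A + t *: DA).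
Let Bt (t : R) := B + t *: DB.
Let Nt t := invmx (1%:M - At t).
Let Tt t := sqrtmx (1%:M + (Bt t)^T *m Bt t).
Let St t := invmx (Tt t).
(** Increment of 1 + B^T B divided by s - t; at s = t it is the derivative. [Qt] plays the same role
    for the root. *)
Let Wt s t := DB^T *m Bt t + (Bt s)^T *m DB.
Let Qt s t := sylvester (Tt s) (Tt t) (Wt s t).
Let Mt t := col_mx (Cay (At t)) (Bt t).

Definition frame_curve (t : R) : 'M[R]_(p + m, p) := Mt t *m St t.

(** Obtained from Ms Ss - Mt St = (Ms - Mt) St + Ms (Ss - St) on dividing by s - t. *)
Let slope s t :=
  col_mx (Nt s *m DA *m Nt t) DB *m St t - Mt s *m St s *m Qt s t *m St t.

Let Tt_root t : gram_root (Bt t) (Tt t) := gram_root_sqrtmx (Bt t).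
Let Tt_unit t : Tt t \in unitmx := posdefmx_unit (Tt_root t).1.

Let At_skew t : (At t)^T = - At t.
Proof.
by rewrite /At linearZ linearD linearZ /= As DAs scalerN -opprD -scalerN.
Qed.

(* As in Caratheodory's criterion, every function [f] of the parameter is handled
   through a factor [q] with [f s - f t = (s - t) *: q s t], where [q] is continuous
   at the diagonal and [q t t] is the derivative. *)
Let Bt_slope s t : Bt s - Bt t = (s - t) *: DB.
Proof. by rewrite /Bt opprD addrACA subrr add0r -scalerBl. Qed.

(** Resolvent identity Ns - Nt = Ns (As - At) Nt. The factor 1/2 of [At] later cancels the 2 in
    [CayE]. *)
Let Nt_slope s t : Nt s - Nt t = (s - t) *: (2^-1 *: (Nt s *m DA *m Nt t)).
Proof.
have us := skew_unit (At_skew s); have ut := skew_unit (At_skew t).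
have -> : Nt s - Nt t = Nt s *m (At s - At t) *m Nt t.
  have -> : At s - At t = (1%:M - At t) - (1%:M - At s).
    by rewrite [in RHS]opprD opprK addrACA subrr add0r addrC.
  by rewrite mulmxBr mulVmx // mulmxBl mulmxK // mul1mx.
have -> : At s - At t = (s - t) *: (2^-1 *: DA).
  by rewrite /At -scalerBr opprD addrACA subrr add0r -scalerBl !scalerA mulrC.
by rewrite -!scalemxAr -!scalemxAl.
Qed.

Let Cay_slope s t : Cay (At s) - Cay (At t) = (s - t) *: (Nt s *m DA *m Nt t).
Proof.
rewrite !CayE // -/(Nt s) -/(Nt t) opprD addrACA subrr addr0 -scalerBr.
by rewrite Nt_slope !scalerA; congr (_ *: _); field.
Qed.

(** The left side telescopes to Ts^2 - Tt^2, a difference of squares valid without commutation. *)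
Let Tt_diff s t :
  Tt s *m (Tt s - Tt t) + (Tt s - Tt t) *m Tt t = (s - t) *: Wt s t.
Proof.
rewrite mulmxBr mulmxBl addrA subrK (Tt_root s).2 (Tt_root t).2.
rewrite opprD addrACA subrr add0r /Wt scalerDr scalemxAl scalemxAr -linearZ /=.
rewrite -Bt_slope linearB /=.
by rewrite mulmxBl mulmxBr [RHS]addrC addrA subrK.
Qed.

Let Qt_eq s t : Tt s *m Qt s t + Qt s t *m Tt t = Wt s t.
Proof. exact: sylvesterP (Tt_root s) (Tt_root t). Qed.

(** Both sides solve the same Sylvester equation, whose solution is unique by
    [fnorm_root_sylvester]. *)
Let Tt_slope s t : Tt s - Tt t = (s - t) *: Qt s t.
Proof.
apply/eqP; rewrite -subr_eq0 -fnorm_eq0 eq_le fnorm_ge0 andbT.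
apply: le_trans (fnorm_root_sylvester (Tt_root s) _ (Tt_root t)) _.
rewrite mulmxBr mulmxBl addrACA -opprD Tt_diff -scalemxAr -scalemxAl -scalerDr.
by rewrite Qt_eq subrr le_eqVlt fnorm_eq0 eqxx.
Qed.

Let St_slope s t : St s - St t = (s - t) *: - (St s *m Qt s t *m St t).
Proof.
have -> : St s - St t = - (St s *m (Tt s - Tt t) *m St t).
  by rewrite mulmxBr mulVmx // mulmxBl mulmxK // mul1mx opprB.
by rewrite Tt_slope -scalemxAr -scalemxAl scalerN.
Qed.

Let frame_slope s t : frame_curve s - frame_curve t = (s - t) *: slope s t.
Proof.
have MB : Mt s - Mt t = (s - t) *: col_mx (Nt s *m DA *m Nt t) DB.
  by rewrite opp_col_mx add_col_mx Cay_slope Bt_slope scale_col_mx.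
have MS : (s - t) *: (Mt s *m St s *m Qt s t *m St t) = - (Mt s *m (St s - St t)).
  by rewrite St_slope scalerN mulmxN opprK -scalemxAr !mulmxA.
by rewrite scalerBr scalemxAl -MB MS opprK mulmxBl mulmxBr [RHS]addrC addrA subrK.
Qed.

Let Bt_cts : continuous Bt.
Proof.
by move=> t; apply: cvgD; [exact: cvg_cst | apply: cvgZr_tmp; exact: cvg_id].
Qed.

Let Wt_cvg (T : Type) (F : set_system T) (FF : Filter F) (u v : T -> R) t :
  u x @[x --> F] --> t -> v x @[x --> F] --> t ->
  Wt (u x) (v x) @[x --> F] --> Wt t t.
Proof.
move=> ut vt.
have Bu : Bt (u x) @[x --> F] --> Bt t by apply: continuous_cvg => //; exact: Bt_cts.
have Bv : Bt (v x) @[x --> F] --> Bt t by apply: continuous_cvg => //; exact: Bt_cts.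
apply: cvgD; apply: cvg_mulmx => //; first exact: cvg_cst.
  exact: cvg_trmx.
exact: cvg_cst.
Qed.

Let Tt_cts : continuous Tt.
Proof.
move=> t; apply: (cvg_fnorm_le (e := fun s => (s - t) *: Wt s t)) => [s|].
  rewrite -Tt_diff.
  exact: (fnorm_root_sylvester (Tt_root s) (Tt s - Tt t) (Tt_root t)).
suff : (s - t) *: Wt s t @[s --> t] --> (t - t) *: Wt t t by rewrite subrr scale0r.
apply: cvgZ; first by apply: cvgB; [exact: cvg_id | exact: cvg_cst].
by apply: Wt_cvg; [exact: cvg_id | exact: cvg_cst].
Qed.

Let St_cts : continuous St.
Proof.
move=> t; apply: (cvg_fnorm_le (e := fun s => (Tt t - Tt s) *m St t)) => [s|].
  have -> : St s - St t = St s *m ((Tt t - Tt s) *m St t).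
    by rewrite mulmxBl mulmxV // mulmxBr mulmx1 mulKmx.
  exact: (fnorm_invroot_mul (Tt_root s)).
suff : (Tt t - Tt s) *m St t @[s --> t] --> (Tt t - Tt t) *m St t.
  by rewrite subrr mul0mx.
apply: cvg_mulmx; last exact: cvg_cst.
by apply: cvgB; [exact: cvg_cst | exact: Tt_cts].
Qed.

Let Nt_cts : continuous Nt.
Proof.
move=> t; set Z := 2^-1 *: (DA *m Nt t).
apply: (cvg_fnorm_le (e := fun s => (s - t) *: Z)) => [s|].
  rewrite Nt_slope -mulmxA 2!(scalemxAr _ (Nt s)) -/Z.
  exact: (fnorm_invskew_mul (At_skew s) ((s - t) *: Z)).
suff : (s - t) *: Z @[s --> t] --> (t - t) *: Z.
  by rewrite subrr scale0r.
apply: cvgZ; last exact: cvg_cst.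
by apply: cvgB; [exact: cvg_id | exact: cvg_cst].
Qed.

(** The Sylvester operator at (u, v), applied to the error Q(u, v) - Q(t, t), gives the residual of
    Q(t, t) in the equation at (u, v). This residual tends to 0 and dominates the error. *)
Let Qt_cvg (T : Type) (F : set_system T) (FF : Filter F) (u v : T -> R) t :
  u x @[x --> F] --> t -> v x @[x --> F] --> t ->
  Qt (u x) (v x) @[x --> F] --> Qt t t.
Proof.
move=> ut vt.
have Tu : Tt (u x) @[x --> F] --> Tt t by apply: continuous_cvg => //; exact: Tt_cts.
have Tv : Tt (v x) @[x --> F] --> Tt t by apply: continuous_cvg => //; exact: Tt_cts.
apply: (cvg_fnorm_le (e := fun x =>
  Wt (u x) (v x) - (Tt (u x) *m Qt t t + Qt t t *m Tt (v x)))) => [x|].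
  rewrite -Qt_eq opprD addrACA -mulmxBr -mulmxBl.
  exact: (fnorm_root_sylvester (Tt_root _) (Qt (u x) (v x) - Qt t t) (Tt_root _)).
suff : Wt (u x) (v x) - (Tt (u x) *m Qt t t + Qt t t *m Tt (v x)) @[x --> F]
    --> Wt t t - (Tt t *m Qt t t + Qt t t *m Tt t) by rewrite Qt_eq subrr.
apply: cvgB; first exact: Wt_cvg.
by apply: cvgD; apply: cvg_mulmx => //; exact: cvg_cst.
Qed.

(** Two moving parameters serve two purposes: [v] constant gives the derivative at [t], and [u]
    equal to [v] gives continuity of the derivative. *)
Let slope_cvg (T : Type) (F : set_system T) (FF : Filter F) (u v : T -> R) t :
  u x @[x --> F] --> t -> v x @[x --> F] --> t ->
  slope (u x) (v x) @[x --> F] --> slope t t.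
Proof.
move=> ut vt.
have Su : St (u x) @[x --> F] --> St t by apply: continuous_cvg => //; exact: St_cts.
have Sv : St (v x) @[x --> F] --> St t by apply: continuous_cvg => //; exact: St_cts.
have Nu : Nt (u x) @[x --> F] --> Nt t by apply: continuous_cvg => //; exact: Nt_cts.
have Nv : Nt (v x) @[x --> F] --> Nt t by apply: continuous_cvg => //; exact: Nt_cts.
have Bu : Bt (u x) @[x --> F] --> Bt t by apply: continuous_cvg => //; exact: Bt_cts.
have cst k l (X : 'M[R]_(k, l)) : X @[x --> F] --> X by exact: cvg_cst.
apply: cvgB.
  by apply: cvg_mulmx => //; apply: cvg_col_mx => //; do 2!apply: cvg_mulmx => //.
apply: cvg_mulmx => //; apply: cvg_mulmx; last exact: Qt_cvg.
apply: cvg_mulmx => //.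
apply: cvg_col_mx => //; rewrite CayE //.
under eq_fun do rewrite CayE //.
by apply: cvgB; [apply: cvgZ => //; exact: cvg_cst | exact: cst].
Qed.

Lemma is_derive_frame_curve (t : R) : is_derive t 1 frame_curve (slope t t).
Proof.
apply: (is_derive_slope (q := slope^~ t)) => [s|]; first exact: frame_slope.
exact: (@slope_cvg _ (nbhs t) _ id (cst t) t cvg_id (cvg_cst _)).
Qed.

Lemma derive1_frame_curve : derive1 frame_curve = (fun t => slope t t).
Proof.
by apply/funext => t; rewrite derive1E; have [_ ->] := is_derive_frame_curve t.
Qed.

Lemma continuous_derive1_frame_curve : continuous (derive1 frame_curve).
Proof.
rewrite derive1_frame_curve => t.
exact: (@slope_cvg _ (nbhs t) _ id id t cvg_id cvg_id).
Qed.

Let Mt_gram t : (Mt t)^T *m Mt t = Tt t *m Tt t.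
Proof. by rewrite tr_col_mx mul_row_col Cay_orthogonal // (Tt_root t).2. Qed.

Lemma frame_curve_stiefel t : stiefel R _ _ (frame_curve t).
Proof.
rewrite /stiefel/= /frame_curve trmx_mul -mulmxA (mulmxA _ (Mt t)) Mt_gram.
by rewrite /St mulmxK // trmx_inv (Tt_root t).1.1 mulVmx.
Qed.

Lemma sqn_col_mx n m1 m2 (X : 'M[R]_(m1, n)) (Y : 'M[R]_(m2, n)) :
  sqn (col_mx X Y) = sqn X + sqn Y.
Proof. by rewrite /euclidean_metric tr_col_mx mul_row_col mxtraceD. Qed.

Lemma fnorm_derive1_frame_curve t :
  fnorm (derive1 frame_curve t) <= 3 * fnorm (col_mx DA DB).
Proof.
rewrite derive1_frame_curve; set d := fnorm (col_mx _ _).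
(* The summand [d] pays for the variation of [Mt], and [2 * d] for that of [St]. *)
rewrite (_ : 3 * d = d + 2 * d); last by ring.
apply: le_trans (ler_fnormD _ _) _; rewrite fnormN lerD //.
  apply: le_trans (fnorm_mul_invroot (Tt_root t) _) _.
  rewrite ler_fnorm !sqn_col_mx lerD2r -ler_fnorm.
  apply: le_trans (fnorm_mul_invskew _ (At_skew t)) _.
  exact: fnorm_invskew_mul.
rewrite -mulmxA -/(frame_curve t).
have -> : fnorm (frame_curve t *m (Qt t t *m St t)) = fnorm (Qt t t *m St t).
  rewrite [LHS]fnormE dot_mull mulmxA.
  by have := frame_curve_stiefel t; rewrite /stiefel /= => ->; rewrite mul1mx -fnormE.
apply: le_trans (fnorm_deriv_root (Tt_root t) (D := DB) _) _.
  by rewrite Qt_eq.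
by rewrite ler_pM2l // ler_fnorm sqn_col_mx lerDr sqn_ge0.
Qed.

End curve.

(** * From the speed bound to the distance, and comparison with the arcsine *)

(** The curve competes in the infimum, and its speed is integrated over an interval of measure 1.
    Keeping [n] free with an equation [e] lets case analysis on [e] remove the casts. *)
Lemma dist_E_frame_curve (R : realType) m p n (e : (p + m)%N = n)
    (A DA : 'M[R]_p) (B DB : 'M[R]_(m, p)) : A^T = - A -> DA^T = - DA ->
  (dist_E (castmx (e, erefl p) (frame_curve A DA B DB 0%R))
          (castmx (e, erefl p) (frame_curve A DA B DB 1%R))
    <= (3 * fnorm (col_mx DA DB))%:E)%E.
Proof.
move=> As DAs; case: n / e; rewrite !castmx_id.
set c := frame_curve A DA B DB.
apply: (@le_trans _ _ (curve_length c)).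
  apply: ereal_inf_lbound; exists c => //; split => //.
  (* A single piece with endpoints 0 and 1; the curve, defined on the whole line, is its own
     extension. *)
  - exists [:: 1]; split => //=; first by rewrite ltr01.
    move=> [|//] _ /=; exists c; split => //.
      by move=> t; have [] := is_derive_frame_curve B DB As DAs t.
    exact: continuous_derive1_frame_curve.
  - by move=> t _; exact: frame_curve_stiefel.
rewrite /curve_length.
apply: (@le_trans _ _ (\int[@lebesgue_measure R]_(t in `[0%R, 1%R])
    (cst (3 * fnorm (col_mx DA DB))%:E t))%E); last first.
  by rewrite integral_cst //= lebesgue_measure_itv /= lte_fin ltr01 oppr0 adde0 mule1.
apply: ge0_le_integral => //=.
- apply/measurable_EFinP; apply: measurable_funTS.
  under eq_fun do rewrite -fnormE.
  apply: continuous_measurable_fun => t; apply: cvg_fnorm.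
  exact: continuous_derive1_frame_curve.
- by move=> t _; rewrite lee_fin -fnormE fnorm_derive1_frame_curve.
Qed.

Lemma sin_le_id (R : realType) (x : R) : 0 <= x -> sin x <= x.
Proof.
move=> x0; have [c _] : exists2 c, c \in `[0, x] & sin x - sin 0 = cos c * (x - 0).
  by apply: MVT_segment => //; apply: continuous_subspaceT; exact: continuous_sin.
by rewrite sin0 !subr0 => ->; rewrite ler_piMl // cos_le1.
Qed.

Lemma le_asin (R : realType) (x : R) : 0 <= x <= 1 -> x <= asin x.
Proof.
move=> /andP[x0 x1]; have xI : -1 <= x <= 1 by rewrite x1 (le_trans _ x0) // oppr_le0.
have [/andP[yl yr] sy] := asin_def xI.
rewrite -{1}sy sin_le_id //; case: leP => // y0.
(* A negative [asin x] would lie in [-pi/2, 0), where the sine is negative, against 0 <= x. *)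
suff : sin (asin x) < 0 by rewrite sy ltNge x0.
rewrite -oppr_gt0 -sinN sin_gt0_pi // oppr_gt0 y0 /=.
by have := pi_gt0 R; lra.
Qed.

Lemma castmx_mull (R : pzSemiRingType) q n k l (e : q = n) (M : 'M[R]_(q, k))
    (N : 'M[R]_(k, l)) :
  castmx (e, erefl k) M *m N = castmx (e, erefl l) (M *m N).
Proof. by case: n / e; rewrite !castmx_id. Qed.

(** The endpoint enters through equations, so that one statement serves both t = 0 and t = 1. *)
Lemma phi_CayE (R : realType) n p (hpn : (p <= n)%N) (X : 'M[R]_(p + (n - p), p))
    (DA : 'M[R]_p) (DB : 'M[R]_(n - p, p)) t A B :
  A + t *: DA = usubmx X -> B + t *: DB = dsubmx X ->
  phi_Cay hpn X = castmx (subnKC hpn, erefl p) (frame_curve A DA B DB t).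
Proof.
by rewrite /phi_Cay /frame_curve castmx_mull => -> ->.
Qed.

Theorem theorem3p11 (R : realType) (n p : nat) (hp : (0 < p)%N)
    (hpn : (p <= n)%N) (X Y : 'M[R]_(p + (n - p), p))
    (hX : skew_prod R n p X) (hY : skew_prod R n p Y)
    (hXY : fnorm (X - Y) < 2 / 3) :
  (dist_E (phi_Cay hpn X) (phi_Cay hpn Y)
     <= (2 * asin (3 / 2 * fnorm (X - Y)))%:E)%E.
Proof.
have As : (usubmx X)^T = - usubmx X := hX.
have As' : (usubmx Y)^T = - usubmx Y := hY.
rewrite (@phi_CayE _ _ _ _ X (usubmx Y - usubmx X) (dsubmx Y - dsubmx X) 0
  (usubmx X) (dsubmx X)) ?scale0r ?addr0 //.
rewrite (@phi_CayE _ _ _ _ Y (usubmx Y - usubmx X) (dsubmx Y - dsubmx X) 1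
  (usubmx X) (dsubmx X)) ?scale1r ?subrKC //.
apply: le_trans (dist_E_frame_curve _ _ _ As _) _.
  by rewrite linearB /= As As' opprB opprK addrC.
rewrite -add_col_mx -opp_col_mx !vsubmxK -fnormN opprB lee_fin.
have d0 := fnorm_ge0 (X - Y).
(* The hypothesis |X - Y| < 2/3 places 3/2 |X - Y| in [0, 1]; doubling the inequality gives the
   bound on 3 |X - Y|. *)
have : 3 / 2 * fnorm (X - Y) <= asin (3 / 2 * fnorm (X - Y)).
  by apply: le_asin; apply/andP; split; lra.
lra.
Qed.
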